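(* Let $\mathfrak{M}$ be a von Neumann algebra acting on a complex Hilbert space $\mathcal{H}$, let $A\in\mathfrak{M}$ be a nonzero positive element, and let $P$ be the orthogonal projection onto $\overline{\mathcal{R}(A)}$. The following statements hold. (1) For any $T\in\mathfrak{M}^A$, we have $\sigma^r(PTP, P\mathfrak{M}P)\subseteq\sigma_A^r(T)$ and $\sigma^l(PTP, P\mathfrak{M}P)\subseteq\sigma_A^l(T)$. (2) Let $T\in\mathfrak{M}_A$ and $L\in\mathfrak{M}^A$ be such that $A^{1/2}T=L^*A^{1/2}$. Then $\|T\|_A=\|PLP\|=\|PL\|$ and $\|L\|_A=\|PTP\|=\|PT\|$. (3) Let $T\in\mathfrak{M}_A$ and $L\in\mathfrak{M}^A$ be such that $A^{1/2}T=L^*A^{1/2}$, and let $\lambda\in\mathbb{C}$ be such that $\max(\|T\|_A,\|L\|_A)<|\lambda|$. Then $\lambda I\pm T$ and $\overline{\lambda} I\pm T$ are $A$-invertible in $\mathfrak{M}^A$.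
   Context: A von Neumann algebra $\mathfrak{M}$ on $\mathcal{H}$ is a weak-operator closed $*$-subalgebra of $\mathcal{B}(\mathcal{H})$ containing the identity $I$; $\mathcal{R}(\cdot)$ denotes range. The projection $P$ belongs to $\mathfrak{M}$. For $h\in\mathcal{H}$ put $\|h\|_A=\sqrt{\langle Ah,h\rangle}$, and for $T\in\mathfrak{M}$ put $\|T\|_A=\sup\{\|Th\|_A:\ h\in\mathcal{H},\ \|h\|_A=1\}\in[0,\infty]$ (equivalently, $\|T\|_A=\sup_f\sqrt{f(T^*AT)}$ over positive linear functionals $f$ on $\mathfrak{M}$ with $f(A)=1$). Set $\mathfrak{M}^A=\{T\in\mathfrak{M}:\|T\|_A<\infty\}$; equivalently, $\mathfrak{M}^A$ is the set of $T\in\mathfrak{M}$ admitting an $A^{1/2}$-adjoint, i.e. some $S\in\mathfrak{M}$ with $A^{1/2}S=T^*A^{1/2}$. $\mathfrak{M}_A$ is the set of $T\in\mathfrak{M}$ admitting an $A$-adjoint, i.e. some $S\in\mathfrak{M}$ with $AS=T^*A$; one has $\mathfrak{M}_A\subseteq\mathfrak{M}^A$. $T\in\mathfrak{M}^A$ is left (resp. right) $A$-invertible in $\mathfrak{M}^A$ if there is $S\in\mathfrak{M}^A$ with $AST=A$ (resp. $ATS=A$), and $A$-invertible in $\mathfrak{M}^A$ if there is $S\in\mathfrak{M}^A$ with $ATS=AST=A$. The left (resp. right) $A$-spectrum $\sigma_A^l(T)$ (resp. $\sigma_A^r(T)$) is the set of $\lambda\in\mathbb{C}$ such that $\lambda I-T$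 is not left (resp. right) $A$-invertible in $\mathfrak{M}^A$. For $X\in P\mathfrak{M}P$, $\sigma^l(X,P\mathfrak{M}P)$ (resp. $\sigma^r(X,P\mathfrak{M}P)$) is the left (resp. right) spectrum in the algebra $P\mathfrak{M}P$ with unit $P$: the set of $\lambda\in\mathbb{C}$ such that $\lambda P-X$ has no left (resp. right) inverse in $P\mathfrak{M}P$. *)

(* Defs.v *)
From HB Require Import structures.
From mathcomp Require Export all_boot all_order all_algebra.
From mathcomp Require Export complex.
From mathcomp Require Export all_classical all_reals all_analysis.

Set Implicit Arguments.
Unset Strict Implicit.
Unset Printing Implicit Defensive.

Export Order.TTheory GRing.Theory Num.Theory.
Export numFieldNormedType.Exports.

Global Open Scope classical_set_scope.
Global Open Scope complex_scope.
Global Open Scope ring_scope.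

(* {dot H for theta} is linear in its first argument and theta-linear in its
   second one *)
HB.mixin Record NormedModule_isHilbert (R : realType) (H : Type)
    of CompleteNormedModule R[i] H := {
  inner : {dot H for (@Num.conj R[i])} ;
  inner_normE : forall x : H, `|x| ^+ 2 = inner x x
}.

#[short(type="hilbertType")]
HB.structure Definition Hilbert (R : realType) :=
  { H of CompleteNormedModule R[i] H & NormedModule_isHilbert R H }.

Notation "''[' u , v ]" := (inner u v) : ring_scope.

Section Operators.
Context {R : realType} {H : hilbertType R}.
Implicit Types (T S X Y A B P : H -> H) (M V : set (H -> H)).

Definition bounded_operator T :=
  linear T /\ exists c : R[i], forall x, `|T x| <= c * `|x|.

(* S = T^*; a bounded operator has exactly one adjoint *)
Definition is_adjoint T S := forall x y, '[T x, y] = '[x, S y].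

Definition positive_operator A :=
  bounded_operator A /\ forall x, 0 <= '[A x, x].

(* B = A^{1/2}; a positive operator has exactly one positive square root *)
Definition is_sqrt_operator A B := positive_operator B /\ B \o B = A.

(* This determines P and makes it linear when V is a closed subspace *)
Definition is_orthogonal_projection P (V : set H) :=
  forall x, V (P x) /\ forall v, V v -> '[x - P x, v] = 0.

(* The weak operator topology: the coarsest one making T |-> '[T x, y]
   continuous for all x and y *)
Definition matrix_coef T : {ptws (H * H)%type -> (R[i] : numFieldType)} :=
  fun xy => '[T xy.1, xy.2].

Definition weak_operator_topology := initial_topology matrix_coef.

(* An operator is a plain function H -> H, so that weak closedness is relative
   to the bounded operators: a weak limit of a net of bounded operators may be
   unbounded *)
Record von_neumann_algebra (M : set (H -> H)) : Prop := {
  vna_bounded : M `<=` bounded_operator ;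
  vna_id : M idfun ;
  vna_add : forall S T, M S -> M T -> M (S + T) ;
  vna_scale : forall (c : R[i]) T, M T -> M (c *: T) ;
  vna_comp : forall S T, M S -> M T -> M (S \o T) ;
  vna_adjoint : forall T, M T -> exists2 S, M S & is_adjoint T S ;
  vna_wot_closed :
    closure (M : set weak_operator_topology) `&` bounded_operator `<=` M
}.

Local Open Scope ereal_scope.

Definition opnorm T : \bar R :=
  ereal_sup [set (complex.Re `|T h|)%:E | h in [set h : H | (`|h| = 1)%R]].

Definition seminorm A (h : H) : R := Num.sqrt (complex.Re '[A h, h]).

Definition opseminorm A T : \bar R :=
  ereal_sup [set (seminorm A (T h))%:E | h in [set h : H | seminorm A h = 1%R]].

(* M^A *)
Definition A_bounded M A : set (H -> H) :=
  [set T | M T /\ opseminorm A T < +oo].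

(* M_A *)
Definition A_adjointable M A : set (H -> H) :=
  [set T | M T /\
    exists S Ts, [/\ M S, is_adjoint T Ts & A \o S = Ts \o A]].

Definition left_A_invertible M A T :=
  A_bounded M A T /\ exists2 S, A_bounded M A S & A \o S \o T = A.

Definition right_A_invertible M A T :=
  A_bounded M A T /\ exists2 S, A_bounded M A S & A \o T \o S = A.

Definition A_invertible M A T :=
  A_bounded M A T /\
  exists S, [/\ A_bounded M A S, A \o T \o S = A & A \o S \o T = A].

Local Open Scope ring_scope.

Definition left_A_spectrum M A T : set R[i] :=
  [set lam | ~ left_A_invertible M A (lam *: idfun - T)].

Definition right_A_spectrum M A T : set R[i] :=
  [set lam | ~ right_A_invertible M A (lam *: idfun - T)].

Definition corner M P : set (H -> H) := [set P \o X \o P | X in M].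

(* Spectra in an algebra N of operators whose unit is P *)
Definition left_spectrum X (N : set (H -> H)) P : set R[i] :=
  [set lam | ~ exists2 Y, N Y & Y \o (lam *: P - X) = P].

Definition right_spectrum X (N : set (H -> H)) P : set R[i] :=
  [set lam | ~ exists2 Y, N Y & (lam *: P - X) \o Y = P].

End Operators.

(* Main.v *)
Require Import Defs.
From mathcomp Require Import ring lra.

Set Implicit Arguments.
Unset Strict Implicit.
Unset Printing Implicit Defensive.

(** The operators concerned preserve [ker A = ker P]; modulo this kernel,
    [A]-inverses become inverses in the corner [P M P], and the [A]-seminorm
    becomes the norm [|A^{1/2} h|].

    An operator [T] of finite [A]-seminorm maps [ker A] to itself: moving a unit
    vector along [ker A] keeps its seminorm ([opseminorm_fin_ker]). So
    [P T P = P T], and since [A u = A v] is equivalent to [P u = P v],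
    multiplying [A S (lam - T) = A] or [A (lam - T) S = A] by [P] on both sides
    shows that [P S P] inverts [lam P - P T P] on the same side. This is (1).

    If [A^{1/2} T = L^* A^{1/2}], then [|T h|_A = |L^* A^{1/2} h|], so that the
    seminorm of [T] is the norm of [L^*] on the closed range of [A^{1/2}], the
    range of [P]. This is the norm of [L^* P] and of its adjoint [P L]
    ([opseminorm_opnorm]). The relation is symmetric in [T] and [L] up to
    adjoints ([intertwine_adjoint]), which gives the other half of (2).

    For (3), [|P T| = |L|_A < |lam|], so that [lam - P T] has a bounded inverse
    [S], which commutes with [P] because [P T P = P T]. As [A P = A], it is an
    [A]-inverse of [lam - T], and [|T|_A < |lam|] bounds its seminorm
    ([A_invertible_scalar_sub]). It remains to see that [S] belongs to the
    algebra: it is a strong limit of polynomials in [P T] ([neumann_inverse]),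
    and [P] itself is a strong limit of polynomials in [A] ([vna_proj]). The
    signs and the conjugate in (3) only change [lam] within its circle or
    replace [T] by [- T]. *)

(** * The real-valued norm of a Hilbert space *)

Section Norm.
Context {R : realType} {H : hilbertType R}.
Implicit Types (x y u v : H) (c : R[i]).

(** The norm of the space takes its values in [R[i]]; real estimates, in
    particular those closed by linear arithmetic, go through this copy. *)
Definition rnorm x : R := complex.Re `|x|.

Lemma rnormE x : `|x| = (rnorm x)%:C.
Proof. by rewrite /rnorm RRe_real ?normr_real. Qed.

Lemma cabsE c : `|c| = (complex.Re `|c|)%:C.
Proof. by rewrite RRe_real ?normr_real. Qed.

Lemma cabs_real (t : R) : 0 <= t -> complex.Re `|t%:C| = t.
Proof. by move=> t0; rewrite ger0_norm// ler0c. Qed.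

Lemma rnorm_ge0 x : 0 <= rnorm x.
Proof. by rewrite -lecR -rnormE; exact: normr_ge0. Qed.

Lemma rnorm_eq0 x : rnorm x = 0 -> x = 0.
Proof. by move=> h; apply: normr0_eq0; rewrite rnormE h. Qed.

Lemma rnorm0 : rnorm (0 : H) = 0.
Proof. by rewrite /rnorm normr0. Qed.

Lemma rnormD x y : rnorm (x + y) <= rnorm x + rnorm y.
Proof. by rewrite -lecR rmorphD /= -!rnormE ler_normD. Qed.

Lemma rnormZ c x : rnorm (c *: x) = complex.Re `|c| * rnorm x.
Proof. by rewrite /rnorm normrZ rnormE cabsE -rmorphM. Qed.

Lemma rnormN x : rnorm (- x) = rnorm x.
Proof. by rewrite /rnorm normrN. Qed.

Lemma rnormB x y : rnorm (x - y) = rnorm (y - x).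
Proof. by rewrite -rnormN opprB. Qed.

Lemma innerDl x y u : '[x + y, u] = '[x, u] + '[y, u].
Proof. exact: linearDl. Qed.
Lemma innerDr x y u : '[u, x + y] = '[u, x] + '[u, y].
Proof. exact: linearDr. Qed.
Lemma innerNl x u : '[- x, u] = - '[x, u].
Proof. exact: linearNl. Qed.
Lemma innerNr x u : '[u, - x] = - '[u, x].
Proof. exact: linearNr. Qed.
Lemma innerZl c x u : '[c *: x, u] = c * '[x, u].
Proof. exact: linearZl_LR. Qed.
Lemma innerZr c x u : '[u, c *: x] = c^*%C * '[u, x].
Proof. exact: (@linearZr_LR _ _ _ _ _ _ _ u). Qed.
Lemma inner0l u : '[0 : H, u] = 0.
Proof. exact: linear0l. Qed.
Lemma inner0r u : '[u, 0 : H] = 0.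
Proof. exact: linear0r. Qed.
Lemma innerC x y : '[x, y] = ('[y, x])^*%C.
Proof. by rewrite hermC expr0 mul1r. Qed.
Lemma Re_inner_sqr x : complex.Re '[x, x] = rnorm x ^+ 2.
Proof. by rewrite -inner_normE rnormE -rmorphXn. Qed.

Lemma rnorm_inner0 x : '[x, x] = 0 -> x = 0.
Proof.
by rewrite -inner_normE => /eqP; rewrite expf_eq0 /= normr_eq0 => /eqP.
Qed.


(** The squared norm of [b *: u - p *: v], with [b = '[v, v]] and
    [p = '[u, v]], is [b] times the difference of the two sides. *)
Lemma cauchy_schwarz u v : `|'[u, v]| <= `|u| * `|v|.
Proof.
have [->|v0] := eqVneq v 0; first by rewrite inner0r !normr0 mulr0.
have b_gt0 : 0 < '[v, v] by rewrite dnorm_gt0.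
rewrite -(@ler_pXn2r _ 2) ?nnegrE ?mulr_ge0// exprMn !inner_normE.
have bJ : ('[v, v])^*%C = '[v, v] by rewrite -innerC.
have := dnorm_ge0 inner ('[v, v] *: u - '[u, v] *: v).
rewrite !innerDl !innerDr !innerNl !innerNr !innerZl !innerZr bJ.
rewrite (innerC v u) sqr_normc => h.
rewrite -subr_ge0 -(pmulr_rge0 _ b_gt0).
by apply: le_trans h _; rewrite le_eqVlt; apply/orP; left; apply/eqP; ring.
Qed.

Lemma Re_le_norm (c : R[i]) : complex.Re c <= complex.Re `|c|.
Proof.
by rewrite (le_trans (ler_norm _))// -lecR -cabsE normc_ge_Re.
Qed.

Lemma Re_cauchy_schwarz u v : complex.Re '[u, v] <= rnorm u * rnorm v.
Proof.
rewrite (le_trans (Re_le_norm _))// -lecR -cabsE rmorphM /= -!rnormE.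
exact: cauchy_schwarz.
Qed.

Lemma cvg_rnormP (u_ : nat -> H) (l : H) :
  u_ @ \oo --> l <->
  forall e : R, 0 < e -> \forall n \near \oo, rnorm (l - u_ n) < e.
Proof.
split=> [/cvgrPdist_lt h e e0|h].
  have e0' : 0 < e%:C :> R[i] by rewrite ltcR.
  by near=> n; rewrite -ltcR -rnormE; near: n; exact: h.
apply/cvgrPdist_lt => e e0.
have eE : (complex.Re e)%:C = e by rewrite RRe_real ?gtr0_real.
near=> n; rewrite rnormE -eE ltcR; near: n; apply: h.
by rewrite -ltcR eE.
Unshelve. all: by end_near. Qed.

Lemma closure_rnorm (V : set H) x (e : R) :
  closure V x -> 0 < e -> exists2 v, V v & rnorm (x - v) < e.
Proof.
move=> Vx e0.
have e0' : 0 < e%:C :> R[i] by rewrite ltcR.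
have [v [Vv]] := Vx _ (nbhsx_ballx x e%:C e0').
rewrite -ball_normE /= => xv; exists v => //.
by rewrite -ltcR -rnormE.
Qed.

Lemma cauchy_rnorm (u_ : nat -> H) :
  (forall e : R, 0 < e ->
    exists N, forall k, rnorm (u_ (N + k)%N - u_ N) < e) ->
  exists l : H, u_ @ \oo --> l.
Proof.
move=> h.
suff : cauchy (u_ @ \oo).
  by move=> /cauchy_cvg; exists (lim (u_ @ \oo : set_system H)).
apply/cauchyP => e e0.
have eE : (complex.Re e)%:C = e by rewrite RRe_real ?gtr0_real.
have [|N hN] := h (complex.Re e); first by rewrite -ltcR eE.
exists (u_ N); exists N => // n /= Nn.
rewrite -ball_normE /= rnormE -eE ltcR rnormB.
by rewrite -(subnKC Nn).
Qed.

Lemma geometric_small (q b e : R) : 0 <= q -> q < 1 -> 0 < e ->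
  \forall n \near \oo, q ^+ n * b < e.
Proof.
move=> q0 q1 e0.
have /cvgrPdist_lt/(_ e e0) : q ^+ n * b @[n --> \oo] --> (0 : R).
  rewrite -[X in _ --> X](mul0r b); apply: cvgMr_tmp.
  by apply: cvg_expr; rewrite ger0_norm.
apply: filterS => n; rewrite sub0r normrN; exact/le_lt_trans/ler_norm.
Qed.

End Norm.

(** * Bounded and positive operators *)

Section BoundedOperators.
Context {R : realType} {H : hilbertType R}.
Implicit Types (x y u v k : H) (c : R[i]) (T S A B P : H -> H).

Lemma lin_D T x y : linear T -> T (x + y) = T x + T y.
Proof. by move=> hT; have := hT 1 x y; rewrite !scale1r. Qed.

Lemma lin_0 T : linear T -> T 0 = 0.
Proof. by move=> hT; apply: (addrI (T 0)); rewrite -lin_D// !addr0. Qed.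

Lemma lin_Z T c x : linear T -> T (c *: x) = c *: T x.
Proof. by move=> hT; have := hT c x 0; rewrite addr0 lin_0// addr0. Qed.

Lemma lin_N T x : linear T -> T (- x) = - T x.
Proof. by move=> hT; rewrite -scaleN1r lin_Z// scaleN1r. Qed.

Lemma lin_B T x y : linear T -> T (x - y) = T x - T y.
Proof. by move=> hT; rewrite lin_D// lin_N. Qed.

Lemma bounded_rnorm T : bounded_operator T ->
  exists2 c : R, 0 < c & forall x, rnorm (T x) <= c * rnorm x.
Proof.
move=> [_ [c hc]]; exists (Num.max 1 (complex.Re `|c|)).
  by rewrite lt_max ltr01.
move=> x; apply: (@le_trans _ _ (complex.Re `|c| * rnorm x)); last first.
  by rewrite ler_wpM2r ?rnorm_ge0// le_max lexx orbT.
rewrite -lecR rmorphM /= -!rnormE -cabsE -[X in _ * X]normr_id -normrM.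
by rewrite ger0_norm ?(le_trans _ (hc x)).
Qed.

Lemma rnorm_bounded T (c : R) : linear T ->
  (forall x, rnorm (T x) <= c * rnorm x) -> bounded_operator T.
Proof.
move=> lT h; split=> //; exists c%:C => x.
by rewrite !rnormE -rmorphM lecR.
Qed.

Lemma inner_ext u v : (forall x, '[x, u] = '[x, v]) -> u = v.
Proof.
move=> h; apply/eqP; rewrite -subr_eq0; apply/eqP/rnorm_inner0.
by rewrite innerDr innerNr h subrr.
Qed.

Lemma adjoint_unique T S1 S2 : is_adjoint T S1 -> is_adjoint T S2 -> S1 = S2.
Proof.
by move=> h1 h2; apply/funext => y; apply: inner_ext => x; rewrite -h1.
Qed.

Lemma adjoint_sym T S x y : is_adjoint T S -> '[S x, y] = '[x, T y].
Proof. by move=> h; rewrite innerC -h -innerC. Qed.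

(** The form [q u v = '[A u, v] - '[u, A v]] is sesquilinear and vanishes on
    the diagonal because a positive number is real. Polarizing with [x + y]
    and [x + 'i *: y] gives [q x y = - q y x] and [q x y = q y x]. *)
Lemma positive_selfadjoint A : positive_operator A -> is_adjoint A A.
Proof.
move=> [[lA _] A0] x y; apply/eqP; rewrite -subr_eq0; apply/eqP.
pose q u v := '[A u, v] - '[u, A v].
have q0 u : q u u = 0.
  rewrite /q [X in _ - X]innerC -(RRe_real (ger0_real (A0 u))).
  by rewrite conjc_real subrr.
have q0' u : '[A u, u] = '[u, A u] by apply/subr0_eq/q0.
have h1 : q x y + q y x = 0.
  have := q0 (x + y); rewrite /q lin_D// !innerDl !innerDr !q0' => <-; ring.
have h2 : q x y - q y x = 0.
  have [j j0 jJ] : exists2 j : R[i], j != 0 & j^*%C = - j.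
    by exists 'i%C; [rewrite eq_complex /= oner_eq0 andbF | simpc].
  have := q0 (x + j *: y); rewrite /q lin_D// lin_Z// !innerDl !innerDr.
  rewrite !innerZl !innerZr !q0' jJ => h.
  by apply: (mulfI j0); rewrite mulr0 -oppr0 -[in RHS]h; ring.
have qs : q x y = q y x by apply: subr0_eq.
by move: h1; rewrite -qs -mulr2n => /eqP; rewrite mulrn_eq0 => /eqP.
Qed.

(** Positivity of [A] at [x - c^-1 *: A x], where [c] bounds the norm of [A].
    This yields both that ['[A x, x] = 0] forces [A x = 0], without a square
    root of [A], and that [1 - c^-1 *: A] is a contraction. *)
Lemma positive_bound A : positive_operator A ->
  exists2 c : R, 0 < c & forall x, rnorm (A x) ^+ 2 <= c * complex.Re '[A x, x].
Proof.
move=> Ap; have sA := positive_selfadjoint Ap; have [bA A0] := Ap.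
have lA := bA.1.
have [c c0 hc] := bounded_rnorm bA; exists c => // x.
have := A0 (x - (c^-1)%:C *: A x).
rewrite lecE => /andP[_].
rewrite lin_B// lin_Z// !innerDl !innerDr !innerNl !innerNr !innerZl !innerZr.
rewrite conjc_real (sA (A x) x).
have : complex.Re '[A (A x), A x] <= c * rnorm (A x) ^+ 2.
  rewrite (le_trans (Re_cauchy_schwarz _ _))// expr2 mulrA.
  by rewrite ler_wpM2r ?rnorm_ge0.
have := Re_inner_sqr (A x).
case: ('[A (A x), A x]) => a a'; case: ('[A x, A x]) => b b'.
case: ('[A x, x]) => d d' /= -> h1 h2.
rewrite -subr_ge0.
set n := rnorm (A x) ^+ 2 in h1 h2 *.
have : 0 <= d - 2 * c^-1 * n + c^-1 ^+ 2 * (c * n).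
  apply: le_trans h2 _.
  have := ler_wpM2l (sqr_ge0 c^-1) h1; simpc.
  rewrite expr2; lra.
have -> : c^-1 ^+ 2 * (c * n) = c^-1 * n by field; rewrite gt_eqF.
move=> h3; have -> : c * d - n = c * (d - 2 * c^-1 * n + c^-1 * n).
  by field; rewrite gt_eqF.
by rewrite mulr_ge0// ltW.
Qed.

End BoundedOperators.

(** * The projection onto the closed range of a positive operator *)

Section RangeProjection.
Context {R : realType} {H : hilbertType R} (A P : H -> H).
Hypothesis Apos : positive_operator A.
Hypothesis HP : is_orthogonal_projection P (closure (range A)).
Implicit Types (x y u v k : H) (e : R).

Let lA : linear A := Apos.1.1.
Let sA := positive_selfadjoint Apos.

Lemma proj_dense x e : 0 < e -> exists g, rnorm (P x - A g) < e.
Proof.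
move=> e0; have [_ [g _ <-] h] := closure_rnorm (HP x).1 e0.
by exists g.
Qed.

(** [P x - x] is orthogonal to the range of the self-adjoint [A], hence lies in
    its kernel. *)
Lemma A_proj x : A (P x) = A x.
Proof.
apply/esym/subr0_eq; rewrite -lin_B//; apply: inner_ext => y.
rewrite inner0r -sA innerC (HP x).2 ?conjc0//.
by apply: subset_closure; exists y.
Qed.

Lemma proj_orth_ker x k : A k = 0 -> '[P x, k] = 0.
Proof.
move=> Ak; apply/eqP/negPn/negP => ne0.
have m0 : 0 < complex.Re `|'[P x, k]|.
  by rewrite -ltcR -cabsE normr_gt0.
have k0 : 0 < rnorm k + 1 by rewrite ltr_pwDr// rnorm_ge0.
have [g hg] := @proj_dense x _ (divr_gt0 m0 k0).
have E : '[P x, k] = '[P x - A g, k].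
  by rewrite innerDl innerNl (sA g k) Ak inner0r subr0.
have := cauchy_schwarz (P x - A g) k.
rewrite -E !rnormE cabsE -rmorphM /= lecR => h.
move: hg; rewrite ltr_pdivlMr// ltNge => /negP; apply.
apply: le_trans h _; rewrite ler_wpM2l ?rnorm_ge0//; lra.
Qed.

(** A vector of [ker A] orthogonal to [ker A] is null. All algebraic properties
    of [P] follow: its values are orthogonal to [ker A], and [A \o P = A]. *)
Lemma eq_mod_ker u v :
  A u = A v -> (forall k, A k = 0 -> '[u - v, k] = 0) -> u = v.
Proof.
move=> Auv h; apply/subr0_eq/rnorm_inner0/h.
by rewrite lin_B// Auv subrr.
Qed.

Lemma proj_eq x y : A x = A y -> P x = P y.
Proof.
move=> Axy; apply: eq_mod_ker => [|k Ak]; first by rewrite !A_proj.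
by rewrite innerDl innerNl !proj_orth_ker// subrr.
Qed.

Lemma proj_linear : linear P.
Proof.
move=> c x y; apply: eq_mod_ker => [|k Ak]; first by rewrite !(lA, A_proj).
by rewrite innerDl innerNl innerDl innerZl !proj_orth_ker// mulr0 addr0 subrr.
Qed.

Lemma proj_id x : (forall k, A k = 0 -> '[x, k] = 0) -> P x = x.
Proof.
move=> h; apply: eq_mod_ker => [|k Ak]; first by rewrite A_proj.
by rewrite innerDl innerNl proj_orth_ker// h// subrr.
Qed.

Lemma proj_idem x : P (P x) = P x.
Proof. by apply: proj_id => k Ak; exact: proj_orth_ker. Qed.

Lemma proj_selfadjoint : is_adjoint P P.
Proof.
have PP x y : '[P x, y] = '[P x, P y].
  apply/subr0_eq; rewrite -innerNr -innerDr proj_orth_ker//.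
  by rewrite lin_B// A_proj subrr.
by move=> x y; rewrite PP [RHS]innerC (PP y x) -innerC.
Qed.

Lemma proj_le x : rnorm (P x) <= rnorm x.
Proof.
have [Px0|Px0] := eqVneq (rnorm (P x)) 0; first by rewrite Px0 rnorm_ge0.
have Pgt0 : 0 < rnorm (P x) by rewrite lt0r Px0 rnorm_ge0.
rewrite -(ler_pM2l Pgt0) -expr2 -Re_inner_sqr proj_selfadjoint proj_idem.
by rewrite -proj_selfadjoint Re_cauchy_schwarz.
Qed.

Lemma proj_bounded : bounded_operator P.
Proof.
by apply: (@rnorm_bounded _ _ _ 1 proj_linear) => x; rewrite mul1r proj_le.
Qed.

End RangeProjection.

(** * Strong limits in a von Neumann algebra *)

Section VonNeumannAlgebra.
Context {R : realType} {H : hilbertType R} (M : set (H -> H)).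
Hypothesis HM : von_neumann_algebra M.
Implicit Types (T : H -> H).

Lemma vna_opp T : M T -> M (- T).
Proof. by move=> MT; rewrite -scaleN1r; exact: vna_scale. Qed.

Lemma vna_sub T S : M T -> M S -> M (T - S).
Proof. by move=> MT MS; apply: vna_add => //; exact: vna_opp. Qed.

(** A pointwise limit in norm is a limit in the weak operator topology, by
    Cauchy-Schwarz. *)
Lemma vna_strong_limit (T_ : nat -> H -> H) T :
  (forall n, M (T_ n)) -> bounded_operator T ->
  (forall x, T_ n x @[n --> \oo] --> T x) -> M T.
Proof.
move=> MT bT h; apply: (vna_wot_closed HM); split=> // B.
have coef_cvg : matrix_coef \o T_ @ \oo --> matrix_coef T.
  apply/pointwise_cvgP => -[x y].
  apply/cvgrPdist_lt => e e0 /=.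
  have eE : (complex.Re e)%:C = e by rewrite RRe_real ?gtr0_real.
  have y0 : 0 < rnorm y + 1 by rewrite ltr_pwDr// rnorm_ge0.
  have er : 0 < complex.Re e / (rnorm y + 1) by rewrite divr_gt0// -ltcR eE.
  have /cvg_rnormP/(_ _ er) := h x.
  apply: filterS => n; rewrite ltr_pdivlMr// => hn.
  rewrite /matrix_coef /= -innerNl -innerDl.
  apply: (le_lt_trans (cauchy_schwarz _ _)).
  rewrite !rnormE -rmorphM -eE ltcR; apply: le_lt_trans hn.
  by rewrite ler_wpM2l ?rnorm_ge0//; lra.
move=> [_ [[C Cop <-] Cs sC]].
have /coef_cvg : nbhs (matrix_coef T) C by rewrite nbhsE; exists C.
move=> [N _ hN]; exists (T_ N); split=> //.
by apply: sC; apply: hN => /=.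
Qed.

End VonNeumannAlgebra.

Section RangeProjectionAndNeumannSeries.
Context {R : realType} {H : hilbertType R} (M : set (H -> H)).
Hypothesis HM : von_neumann_algebra M.
Implicit Types (A P T X : H -> H) (x y g : H).

(** With [B = 1 - t *: A] and [t] small, [B] is a contraction which fixes
    [ker A], and the stronger inequality
      [|B x|^2 + t^2 |A x|^2 <= |x|^2]
    telescopes along the powers of [B]: the sum of the [t^2 |B^n (A g)|^2] is at
    most [|g|^2], so that [B^n] tends to [0] on the range of [A], hence on its
    closure. Thus [1 - B^n], a polynomial in [A], tends strongly to [P]. *)
Lemma vna_proj A P : M A -> positive_operator A ->
  is_orthogonal_projection P (closure (range A)) -> M P.
Proof.
move=> MA Ap HP; have lA := Ap.1.1; have sA := positive_selfadjoint Ap.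
have [c c0 hc] := positive_bound Ap.
pose t := c^-1; have t0 : 0 < t by rewrite invr_gt0.
pose B : H -> H := idfun - t%:C *: A.
have BE x : B x = x - t%:C *: A x by [].
have MB : M B by apply: vna_sub => //; [exact: vna_id | exact: vna_scale].
have lB : linear B := (vna_bounded HM MB).1.
have B_fejer x : rnorm (B x) ^+ 2 + t ^+ 2 * rnorm (A x) ^+ 2 <= rnorm x ^+ 2.
  rewrite -!Re_inner_sqr BE !innerDl !innerDr !innerNl !innerNr.
  rewrite !innerZl !innerZr.
  rewrite conjc_real -sA; have := hc x; rewrite -Re_inner_sqr.
  case: ('[A x, A x]) => a a'; case: ('[A x, x]) => b b'.
  case: ('[x, x]) => d d'.
  simpc => /= h.
  have : t * (t * a) <= t * b.
    by rewrite ler_pM2l// /t mulrC ler_pdivrMr// mulrC.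
  rewrite expr2; lra.
have B_le x : rnorm (B x) <= rnorm x.
  rewrite -(@ler_pXn2r _ 2) ?nnegrE ?rnorm_ge0//; apply: le_trans (B_fejer x).
  by rewrite lerDl mulr_ge0// sqr_ge0.
pose W n x := iter n B x.
have lW n : linear (W n).
  by elim: n => [|n IH] k x y //; rewrite /W /= -/(W n _) IH lB.
have W_le n x : rnorm (W n x) <= rnorm x.
  by elim: n => [//|n IH]; apply: le_trans IH; exact: B_le.
have AW n x : A (W n x) = W n (A x).
  elim: n => [//|n IH]; rewrite /W /= -/(W n _) -/(W n (A x)) -IH !BE.
  by rewrite lin_B// lin_Z.
(* the terms of the sum decrease: n times the n-th one is at most the sum *)
have W_sum g n : n%:R * (t ^+ 2 * rnorm (W n (A g)) ^+ 2) + rnorm (W n g) ^+ 2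
    <= rnorm g ^+ 2.
  elim: n => [|n IH]; first by rewrite mul0r add0r.
  apply: le_trans IH; rewrite -natr1 mulrDl mul1r.
  have h1 : rnorm (W n.+1 (A g)) ^+ 2 <= rnorm (W n (A g)) ^+ 2.
    by rewrite ler_pXn2r ?nnegrE ?rnorm_ge0//; exact: B_le.
  have h2 := B_fejer (W n g); rewrite AW -/(W n.+1 g) in h2.
  have h3 := ler_wpM2l (sqr_ge0 t) h1.
  have h4 := ler_wpM2l (ler0n R n) h3.
  lra.
have W_range g (e : R) : 0 < e -> \forall n \near \oo, rnorm (W n (A g)) < e.
  move=> e0; near=> n.
  rewrite -(@ltr_pXn2r _ 2) ?nnegrE ?rnorm_ge0 ?(ltW e0)//.
  have n0 : 0 < (n%:R : R) by rewrite ltr0n; near: n; exact: nbhs_infty_gt.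
  have h : n%:R * (t ^+ 2 * rnorm (W n (A g)) ^+ 2) <= rnorm g ^+ 2.
    by apply: le_trans (W_sum g n); rewrite lerDl sqr_ge0.
  have nb : rnorm g ^+ 2 / (t ^+ 2 * e ^+ 2) < n%:R.
    by near: n; exact: nbhs_infty_gtr.
  rewrite ltr_pdivrMr ?mulr_gt0 ?exprn_gt0// in nb.
  have := le_lt_trans h nb.
  by rewrite ltr_pM2l// ltr_pM2l// exprn_gt0.
apply: (@vna_strong_limit _ _ M HM (fun n => idfun - W n)).
- move=> n; apply: vna_sub => //; first exact: vna_id.
  elim: n => [|n IH]; first exact: vna_id.
  exact: (vna_comp HM MB IH).
- exact: proj_bounded HP.
move=> x; apply/cvg_rnormP => e e0.
have e2 : 0 < e / 2 by rewrite divr_gt0.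
have [g hg] := proj_dense HP x e2.
apply: filterS (W_range g _ e2) => n hn.
have W_ker : W n (x - P x) = x - P x.
  have Ak : A (x - P x) = 0 by rewrite lin_B// (A_proj Ap HP) subrr.
  elim: n {hn} => [//|n IH]; rewrite /W /= -/(W n _) IH BE Ak scaler0 subr0//.
have -> : P x - (idfun - W n) x = W n (P x - A g) + W n (A g).
  have -> : (idfun - W n) x = x - W n x by [].
  have -> : W n x = x - P x + W n (P x) by rewrite -{1}W_ker -lin_D// subrK.
  rewrite -lin_D// subrK.
  have -> : x - (x - P x + W n (P x)) = P x - W n (P x).
    by rewrite opprD addrA subKr.
  by rewrite subKr.
apply: le_lt_trans (rnormD _ _) _; rewrite [e]splitr ltrD//.
exact: le_lt_trans (W_le _ _) hg.
Unshelve. all: by end_near. Qed.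

(** [S y] is the fixed point of the contraction [x |-> mu^-1 *: (y + X x)]. Its
    iterates from [0] are the partial sums of the Neumann series applied to
    [y]; they depend on [y] through elements of [M], and [S] is their strong
    limit. *)
Lemma neumann_inverse X (a : R) (mu : R[i]) : M X ->
  (forall x, rnorm (X x) <= a * rnorm x) -> 0 <= a -> a < complex.Re `|mu| ->
  exists S, [/\ M S, forall x, mu *: S x - X (S x) = x
                & forall x, S (mu *: x - X x) = x].
Proof.
move=> MX hX a0 am; have [lX _] := vna_bounded HM MX.
pose m := complex.Re `|mu|; rewrite -/m in am.
have m0 : 0 < m by exact: le_lt_trans am.
have mu0 : mu != 0 by rewrite -normr_gt0 cabsE ltcR.
have muV : complex.Re `|mu^-1| = m^-1.
  by rewrite normfV cabsE -fmorphV.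
pose q := a / m.
have q0 : 0 <= q by rewrite divr_ge0// ltW.
have q1 : q < 1 by rewrite ltr_pdivrMr// mul1r.
pose F y x := mu^-1 *: (y + X x).
have F_lip y u v : rnorm (F y u - F y v) <= q * rnorm (u - v).
  rewrite /F -scalerBr opprD addrACA subrr add0r -lin_B// rnormZ muV.
  by rewrite /q mulrAC [leRHS]mulrC ler_pM2l ?invr_gt0.
pose S_ n y := iter n (F y) 0.
have MS n : M (S_ n).
  elim: n => [|n IH].
    have -> : S_ 0%N = (0 : R[i]) *: idfun.
      by apply/funext => y; rewrite /= scale0r.
    by apply: (vna_scale HM); exact: vna_id.
  apply: (vna_scale HM); apply: (vna_add HM); first exact: vna_id.
  exact: (vna_comp HM MX IH).
have S_bound n y : rnorm (S_ n y) <= rnorm y / (m - a).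
  have ma : 0 < m - a by rewrite subr_gt0.
  elim: n => [|n IH]; first by rewrite /= rnorm0 divr_ge0 ?rnorm_ge0 ?ltW.
  rewrite /= -/(S_ n y) /F rnormZ muV mulrC ler_pdivrMr//.
  apply: le_trans (rnormD _ _) _.
  have -> : rnorm y / (m - a) * m = rnorm y + a * (rnorm y / (m - a)).
    by field; rewrite gt_eqF.
  by rewrite lerD2l (le_trans (hX _))// ler_wpM2l.
have S_cauchy n k y :
    rnorm (S_ (n + k)%N y - S_ n y) <= q ^+ n * (rnorm y / (m - a)).
  elim: n => [|n IH]; first by rewrite expr0 mul1r add0n subr0.
  rewrite addSn /= -/(S_ _ y) -/(S_ n y) (le_trans (F_lip _ _ _))//.
  by rewrite exprS -mulrA ler_wpM2l.
have S_cvg y : exists l : H, S_ n y @[n --> \oo] --> l.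
  apply: cauchy_rnorm => e e0.
  have [N _ hN] := geometric_small (rnorm y / (m - a)) q0 q1 e0.
  by exists N => k; apply: le_lt_trans (S_cauchy _ _ _) (hN N _) => /=.
pose S y := projT1 (cid (S_cvg y)).
have SP y : S_ n y @[n --> \oo] --> S y := projT2 (cid (S_cvg y)).
have X_inj u v : mu *: u - X u = mu *: v - X v -> u = v.
  move=> h; apply/subr0_eq/rnorm_eq0/eqP; rewrite eq_le rnorm_ge0 andbT.
  have e : mu *: (u - v) = X (u - v).
    apply/subr0_eq; rewrite scalerBr lin_B// opprD addrACA -opprD h.
    by rewrite subrr.
  have := hX (u - v); rewrite -e rnormZ -/m => h'.
  rewrite leNgt; apply/negP => w0.
  by move: h'; rewrite ler_pM2r// leNgt am.
have S_eq y : mu *: S y - X (S y) = y.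
  suff SF : S y = F y (S y).
    by rewrite {1}SF /F scalerA mulfV// scale1r addrK.
  apply/subr0_eq/rnorm_eq0/eqP; rewrite eq_le rnorm_ge0 andbT leNgt.
  apply/negP; set d := rnorm _ => d0.
  have d2 : 0 < d / 2 by rewrite divr_gt0.
  have /cvg_rnormP/(_ _ d2)[N _ hN] := SP y.
  have h1 : rnorm (S y - S_ N.+1 y) < d / 2 by apply: hN => /=.
  have h2 : rnorm (S_ N.+1 y - F y (S y)) < d / 2.
    rewrite (le_lt_trans (F_lip _ _ _))// rnormB.
    apply: le_lt_trans (hN N (leqnn N)).
    by rewrite ler_piMl ?rnorm_ge0// ltW.
  have := rnormD (S y - S_ N.+1 y) (S_ N.+1 y - F y (S y)).
  have -> : S y - S_ N.+1 y + (S_ N.+1 y - F y (S y)) = S y - F y (S y).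
    by rewrite addrA subrK.
  rewrite -/d; lra.
have lS : linear S.
  move=> c x y; apply: X_inj; rewrite S_eq lX scalerDr opprD addrACA S_eq.
  by rewrite scalerA mulrC -scalerA -scalerBr S_eq.
have bS : bounded_operator S.
  apply: (@rnorm_bounded _ _ _ (m - a)^-1) => // x.
  rewrite mulrC ler_pdivlMr ?subr_gt0// mulrBr.
  have := rnormD (mu *: S x - X (S x)) (X (S x)).
  rewrite subrK S_eq rnormZ -/m; have := hX (S x); lra.
exists S; split=> //; first exact: (vna_strong_limit HM MS bS SP).
by move=> x; apply: X_inj; rewrite S_eq.
Qed.

End RangeProjectionAndNeumannSeries.

(** * Norms as suprema over unit spheres *)

Lemma ereal_eq_ub {R : realType} (x y : \bar R) : (0 <= x)%E -> (0 <= y)%E ->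
  (forall c : R, 0 <= c -> (x <= c%:E)%E <-> (y <= c%:E)%E) -> x = y.
Proof.
have le (a b : \bar R) : (0 <= b)%E ->
    (forall c : R, 0 <= c -> (b <= c%:E)%E -> (a <= c%:E)%E) -> (a <= b)%E.
  case: b => [r| |] //; first by rewrite lee_fin => r0; apply.
  by move=> _ _; rewrite leey.
move=> x0 y0 h; apply/eqP; rewrite eq_le; apply/andP; split.
  by apply: le => // c c0; apply: (h c c0).2.
by apply: le => // c c0; apply: (h c c0).1.
Qed.

Section UnitSphereSup.
Context {R : realType} {H : hilbertType R}.
Implicit Types (f N : H -> R) (c : R).

Definition abs_homogeneous f :=
  forall (t : R[i]) x, f (t *: x) = complex.Re `|t| * f x.

Lemma unit_sphere_normalize N x : abs_homogeneous N -> 0 < N x ->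
  N ((N x)^-1%:C *: x) = 1.
Proof.
by move=> hN Nx; rewrite hN cabs_real ?invr_ge0 ?ltW// mulVf ?gt_eqF.
Qed.

(** Both [opnorm] and [opseminorm] are suprema over a unit sphere of an
    absolutely homogeneous function. Such a supremum is the best constant in
    [f <= c * N] only if [f] vanishes where [N] does, the case which rescaling
    to the sphere misses. *)
Lemma sup_unit_sphere_leP f N c : abs_homogeneous f -> abs_homogeneous N ->
  (forall x, 0 <= N x) -> (forall x, N x = 0 -> f x = 0) ->
  (ereal_sup [set (f h)%:E | h in [set h | (N h = 1)%R]] <= c%:E)%E <->
  (forall x, f x <= c * N x).
Proof.
move=> hf hN N0 fN; split=> [h x|h]; last first.
  apply: ge_ereal_sup => _ [x /= Nx <-]; rewrite lee_fin.
  by have := h x; rewrite Nx mulr1.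
have [Nx|Nx] := eqVneq (N x) 0; first by rewrite fN// Nx mulr0.
have Nx0 : 0 < N x by rewrite lt0r Nx N0.
have : ((f ((N x)^-1%:C *: x)%R)%:E <= c%:E)%E.
  apply: le_trans h; apply: ereal_sup_ubound.
  by exists ((N x)^-1%:C *: x) => //; exact: unit_sphere_normalize.
by rewrite lee_fin hf cabs_real ?invr_ge0// mulrC ler_pdivrMr.
Qed.

Lemma sup_unit_sphere_ge0 f N x : abs_homogeneous N ->
  (forall x, 0 <= f x) -> 0 < N x ->
  (0 <= ereal_sup [set (f h)%:E | h in [set h | (N h = 1)%R]])%E.
Proof.
move=> hN f0 Nx; apply: (@le_trans _ _ (f ((N x)^-1%:C *: x))%:E).
  by rewrite lee_fin.
apply: ereal_sup_ubound.
by exists ((N x)^-1%:C *: x) => //; exact: unit_sphere_normalize.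
Qed.

Lemma rnorm_comp_homogeneous (T : H -> H) : linear T ->
  abs_homogeneous (rnorm \o T).
Proof. by move=> lT t x /=; rewrite lin_Z// rnormZ. Qed.

Lemma opnormE (T : H -> H) : opnorm T =
  ereal_sup [set (rnorm (T h))%:E | h in [set h | (rnorm h = 1)%R]].
Proof.
rewrite /opnorm; congr (ereal_sup (image _ _)).
apply/seteqP; split=> h /=; rewrite rnormE; first by move=> [].
by move=> ->.
Qed.

Lemma opnorm_leP (T : H -> H) c : linear T ->
  (opnorm T <= c%:E)%E <-> (forall x, rnorm (T x) <= c * rnorm x).
Proof.
move=> lT; rewrite opnormE; apply: sup_unit_sphere_leP.
- exact: rnorm_comp_homogeneous.
- exact: rnormZ.
- exact: rnorm_ge0.
- by move=> x /rnorm_eq0 ->; rewrite lin_0// rnorm0.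
Qed.

Lemma opnorm_ge0 (T : H -> H) (x : H) : x != 0 -> (0 <= opnorm T)%E.
Proof.
move=> x0; rewrite opnormE; apply: (@sup_unit_sphere_ge0 _ _ x).
- exact: rnormZ.
- by move=> y; exact: rnorm_ge0.
- by rewrite lt0r rnorm_ge0 andbT; apply: contra_neq x0; exact: rnorm_eq0.
Qed.

End UnitSphereSup.

(** * The seminorm of a positive operator *)

Section ASeminorm.
Context {R : realType} {H : hilbertType R} (A : H -> H).
Hypothesis Apos : positive_operator A.
Implicit Types (T : H -> H) (x y k : H).

Let lA : linear A := Apos.1.1.
Let sA := positive_selfadjoint Apos.

Lemma seminorm_sqr x : seminorm A x ^+ 2 = complex.Re '[A x, x].
Proof.
by rewrite sqr_sqrtr//; have := Apos.2 x; rewrite lecE => /andP[].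
Qed.

Lemma seminorm_homogeneous : abs_homogeneous (seminorm A).
Proof.
move=> t x; rewrite /seminorm lin_Z// innerZl innerZr mulrA -sqr_normc.
rewrite cabsE -rmorphXn.
have -> (a : R) (z : R[i]) : complex.Re (a%:C * z) = a * complex.Re z.
  by case: z => u v; simpc.
rewrite sqrtrM ?sqr_ge0// sqrtr_sqr ger0_norm//.
by rewrite -lecR -cabsE; exact: normr_ge0.
Qed.

Lemma seminorm_eq0 x : seminorm A x = 0 -> A x = 0.
Proof.
have [c c0 hc] := positive_bound Apos => h; apply/rnorm_eq0/eqP.
rewrite -sqrf_eq0 eq_le sqr_ge0 andbT; apply: le_trans (hc x) _.
by rewrite -seminorm_sqr h expr0n mulr0.
Qed.

Lemma seminorm_gt0 : A <> 0 -> exists x, 0 < seminorm A x.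
Proof.
move=> A0; apply: contrapT => h; apply: A0; apply/funext => x.
apply: seminorm_eq0; apply/eqP; rewrite eq_le sqrtr_ge0 andbT leNgt.
by apply/negP => hx; apply: h; exists x.
Qed.

(** For [h] of seminorm 1 and [k] in [ker A], all the [h + t *: k] with [t] real
    have seminorm 1, so that [T h + t *: T k] stays bounded in seminorm; hence
    [T k] has seminorm 0. A unit vector [h] exists because [A] is not null. *)
Lemma opseminorm_fin_ker T k : A <> 0 -> linear T ->
  (opseminorm A T < +oo)%E -> A k = 0 -> A (T k) = 0.
Proof.
move=> A0 lT Tfin Ak; have [x hx] := seminorm_gt0 A0.
pose h := (seminorm A x)^-1%:C *: x.
have h1 : seminorm A h = 1.
  by apply: unit_sphere_normalize => //; exact: seminorm_homogeneous.
have [c hc] : exists c : R, forall y, seminorm A y = 1 -> seminorm A (T y) <= c.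
  have fin : opseminorm A T \is a fin_num.
    rewrite ge0_fin_numE//; apply: (@sup_unit_sphere_ge0 _ _ _ _ x) => //.
      exact: seminorm_homogeneous.
    by move=> y; exact: sqrtr_ge0.
  exists (fine (opseminorm A T)) => y y1.
  by rewrite -lee_fin fineK//; apply: ereal_sup_ubound; exists y.
have hc2 (t : R) :
    complex.Re '[A (T h + t%:C *: T k), T h + t%:C *: T k] <= c ^+ 2.
  have e1 : seminorm A (h + t%:C *: k) = 1.
    rewrite -h1 /seminorm lin_D// lin_Z// Ak scaler0 addr0 innerDr innerZr.
    by rewrite (sA h k) Ak inner0r mulr0 addr0.
  have := hc _ e1; rewrite (lin_D _ _ lT) (lin_Z _ _ lT) => h2.
  rewrite -seminorm_sqr ler_pXn2r ?nnegrE ?sqrtr_ge0//.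
  by apply: le_trans h2; exact: sqrtr_ge0.
apply: seminorm_eq0; apply/eqP.
rewrite -sqrf_eq0 eq_le sqr_ge0 andbT seminorm_sqr.
rewrite leNgt; apply/negP => b0.
set b := complex.Re _ in b0.
(* the sum of hc2 at t and - t is free of cross terms *)
have par (t : R) : t ^+ 2 * b <= c ^+ 2.
  have := hc2 t; have := hc2 (- t).
  have := sqr_ge0 (seminorm A (T h)); rewrite seminorm_sqr.
  rewrite !(lin_D _ _ lA) !(lin_Z _ _ lA) !innerDl !innerDr !innerZl !innerZr.
  rewrite !conjc_real /b.
  case: ('[A (T h), T h]) => a1 a2; case: ('[A (T h), T k]) => b1 b2.
  case: ('[A (T k), T h]) => c1 c2; case: ('[A (T k), T k]) => d1 d2.
  simpc => /= ? ? ?; nra.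
(* a t with t >= 1 and t * b > c ^+ 2 *)
have := par (c ^+ 2 / b + 1).
have z0 : 0 <= c ^+ 2 / b by rewrite divr_ge0 ?sqr_ge0// ltW.
have zE : c ^+ 2 / b * b = c ^+ 2 by rewrite divfK// gt_eqF.
rewrite -{2}zE ler_pM2r//; nra.
Qed.

Variable P : H -> H.
Hypothesis HP : is_orthogonal_projection P (closure (range A)).

Lemma proj_compress T : linear T -> (forall k, A k = 0 -> A (T k) = 0) ->
  P \o T \o P = P \o T.
Proof.
move=> lT hT; apply/funext => x /=; apply: (proj_eq Apos HP).
apply/esym/subr0_eq; rewrite -lin_B// -lin_B// hT//.
by rewrite lin_B// (A_proj Apos HP) subrr.
Qed.

Variable B : H -> H.
Hypothesis HB : is_sqrt_operator A B.

Let lB : linear B := HB.1.1.1.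
Let sB := positive_selfadjoint HB.1.
Let AE x : A x = B (B x). Proof. by rewrite -HB.2. Qed.

Lemma seminorm_sqrt x : seminorm A x = rnorm (B x).
Proof.
by rewrite /seminorm AE sB Re_inner_sqr sqrtr_sqr ger0_norm ?rnorm_ge0.
Qed.

Lemma sqrt_ker k : A k = 0 -> B k = 0.
Proof. by move=> Ak; apply: rnorm_inner0; rewrite -sB -AE Ak inner0l. Qed.

Lemma sqrt_proj x : B (P x) = B x.
Proof.
apply/subr0_eq; rewrite -lin_B//; apply: sqrt_ker.
by rewrite lin_B// (A_proj Apos HP) subrr.
Qed.

Lemma proj_sqrt x : P (B x) = B x.
Proof.
by apply: (proj_id Apos HP) => k /sqrt_ker Bk; rewrite sB Bk inner0r.
Qed.

Lemma intertwine_ker T K : K 0 = 0 -> B \o T = K \o B ->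
  forall k, A k = 0 -> A (T k) = 0.
Proof.
move=> K0 BT k /sqrt_ker Bk; rewrite AE.
have -> : B (T k) = K (B k) by exact: (congr1 (@^~ k) BT).
by rewrite Bk K0 lin_0.
Qed.

Lemma opseminorm_leP T c : linear T -> (forall k, A k = 0 -> A (T k) = 0) ->
  (opseminorm A T <= c%:E)%E <-> (forall x, rnorm (B (T x)) <= c * rnorm (B x)).
Proof.
move=> lT kT.
have -> : opseminorm A T =
    ereal_sup [set (rnorm (B (T h)))%:E | h in [set h | (rnorm (B h) = 1)%R]].
  rewrite /opseminorm (_ : seminorm A = rnorm \o B)//.
  by apply/funext => x; rewrite seminorm_sqrt.
apply: (@sup_unit_sphere_leP _ _ _ (rnorm \o B)).
- by move=> t x; rewrite !lin_Z// rnormZ.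
- exact: rnorm_comp_homogeneous.
- by move=> x; exact: rnorm_ge0.
- move=> x /rnorm_eq0 Bx; rewrite sqrt_ker ?rnorm0// kT//.
  by rewrite AE Bx lin_0.
Qed.

(** Since [B (T h) = K (B h)], the seminorm of [T] is the norm of [K] on the
    closed range of [B], which is the range of [P]; so it is the norm of
    [K \o P], whose adjoint is [P \o L]. The equality of norms is proved by
    comparing upper bounds: from [|K w| <= c |w|] with [w = P (L x)],
      [|w|^2 = <x, K w> <= c |x| |w|],
    and conversely, with [b = B h] and [v = K b],
      [|v|^2 = <P (L v), b> <= c |v| |b|]. *)
Lemma opseminorm_opnorm T L K : A <> 0 -> linear T -> linear L ->
  bounded_operator K -> is_adjoint L K -> B \o T = K \o B ->
  opseminorm A T = opnorm (P \o L).
Proof.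
move=> A0 lT lL bK LK BT; have lK := bK.1.
have [x0 hx0] := seminorm_gt0 A0.
have BTE x : B (T x) = K (B x) by exact: (congr1 (@^~ x) BT).
have lP := proj_linear Apos HP.
apply: ereal_eq_ub.
- apply: (@sup_unit_sphere_ge0 _ _ _ _ x0) => //.
    exact: seminorm_homogeneous.
  by move=> y; exact: sqrtr_ge0.
- apply: (@opnorm_ge0 _ _ _ x0); apply/eqP => x00.
  by move: hx0; rewrite x00 seminorm_sqrt lin_0// rnorm0 ltxx.
move=> c c0.
rewrite opseminorm_leP//; last by apply: (intertwine_ker _ BT); exact: lin_0.
rewrite opnorm_leP; last by move=> a u v /=; rewrite lL lP.
split=> h x.
- set w := (P \o L) x.
  have Kw : rnorm (K w) <= c * rnorm w.
    have [k k0 hk] := bounded_rnorm bK.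
    apply/ler_addgt0Pr => e e0.
    have kc : 0 < k + c by rewrite ltr_pwDl.
    have [g hg] := @proj_dense _ _ _ _ HP (L x) _ (divr_gt0 e0 kc).
    have h1 : rnorm (K (A g)) <= c * rnorm (A g) by rewrite AE -BTE.
    have h2 := hk (w - A g).
    have h3 : rnorm (A g) <= rnorm w + rnorm (w - A g).
      by rewrite -{1}(subKr w (A g)) (le_trans (rnormD _ _))// rnormN.
    have h4 : rnorm (K w) <= rnorm (K (w - A g)) + rnorm (K (A g)).
      by rewrite -{1}(subrK (A g) w) (lin_D (w - A g) (A g) lK) rnormD.
    move: hg; rewrite ltr_pdivlMr// -/w => hg.
    have := ler_wpM2l c0 h3.
    lra.
  have [w0|w0] := eqVneq (rnorm w) 0; first by rewrite w0 mulr_ge0 ?rnorm_ge0.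
  have wgt0 : 0 < rnorm w by rewrite lt0r w0 rnorm_ge0.
  rewrite -(ler_pM2r wgt0) -expr2 -Re_inner_sqr.
  have Pw : P w = w by exact: (proj_idem Apos HP).
  rewrite {1}/w /= (proj_selfadjoint Apos HP) Pw LK.
  apply: le_trans (Re_cauchy_schwarz _ _) _.
  by rewrite mulrAC mulrC ler_wpM2r ?rnorm_ge0.
- rewrite BTE; set v := K (B x).
  have [v0|v0] := eqVneq (rnorm v) 0; first by rewrite v0 mulr_ge0 ?rnorm_ge0.
  have vgt0 : 0 < rnorm v by rewrite lt0r v0 rnorm_ge0.
  rewrite -(ler_pM2r vgt0) -expr2 -Re_inner_sqr.
  have -> : '[v, v] = '[P (L v), B x].
    by rewrite (proj_selfadjoint Apos HP) proj_sqrt LK.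
  apply: le_trans (Re_cauchy_schwarz _ _) _.
  by rewrite mulrAC ler_wpM2r ?rnorm_ge0//; exact: h.
Qed.

Lemma intertwine_adjoint T Ts L K : is_adjoint L K -> is_adjoint T Ts ->
  B \o T = K \o B -> B \o L = Ts \o B.
Proof.
move=> LK TTs BT; apply/funext => x; apply: inner_ext => y /=.
have BTE : B (T y) = K (B y) by exact: (congr1 (@^~ y) BT).
by rewrite -(sB y) -(adjoint_sym _ _ LK) -BTE (sB (T y)) TTs.
Qed.

Variable M : set (H -> H).
Hypothesis HM : von_neumann_algebra M.
Hypothesis MA : M A.

Lemma bounded_A_bounded T (c : R) : M T ->
  (forall x, rnorm (B (T x)) <= c * rnorm (B x)) -> A_bounded M A T.
Proof.
move=> MT h; split=> //; apply: (@le_lt_trans _ _ c%:E); last by rewrite ltry.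
apply/opseminorm_leP => //; first exact: (vna_bounded HM MT).1.
move=> k /sqrt_ker Bk; have := h k; rewrite Bk rnorm0 mulr0 => h0.
rewrite AE (_ : B (T k) = 0) ?lin_0//.
by apply/rnorm_eq0/eqP; rewrite eq_le h0 rnorm_ge0.
Qed.

(** The [A]-inverse is the inverse [S] of [mu - P T], which exists in [M] by the
    Neumann series because [|P T| <= a < |mu|]. As [P T P = P T], [S] commutes
    with [P], and [A \o P = A] turns the inverse relations into the required
    ones. The seminorm of [S] is finite because [mu *: S x = x + P (T (S x))]
    gives [|mu| |S x|_A <= |x|_A + c |S x|_A]. *)
Lemma A_invertible_scalar_sub T (a c : R) (mu : R[i]) : M T ->
  (forall x, rnorm (B (T x)) <= c * rnorm (B x)) ->
  (forall x, rnorm (P (T x)) <= a * rnorm x) -> P \o T \o P = P \o T ->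
  0 <= a -> a < complex.Re `|mu| -> c < complex.Re `|mu| ->
  A_invertible M A (mu *: idfun - T).
Proof.
move=> MT hc ha PTP a0 am cm.
have lT := (vna_bounded HM MT).1; have lP := proj_linear Apos HP.
have MP := vna_proj HM MA Apos HP.
have PTPE x : P (T (P x)) = P (T x) by exact: (congr1 (@^~ x) PTP).
have [S [MS S1 S2]] := neumann_inverse HM (vna_comp HM MP MT) ha a0 am.
have lS := (vna_bounded HM MS).1.
rewrite /= in S1 S2.
have PS x : P (S x) = S (P x).
  rewrite -[LHS]S2 PTPE; congr S; rewrite -[in RHS](S1 x).
  by rewrite (lin_B _ _ lP) (lin_Z _ _ lP) (proj_idem Apos HP).
have ME : (mu *: idfun - T) = (fun x => mu *: x - T x) by [].
have MmT : M (mu *: idfun - T).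
  apply: (vna_sub HM) => //; apply: (vna_scale HM); exact: (vna_id HM).
split.
  apply: (@bounded_A_bounded _ (complex.Re `|mu| + c)) => // x.
  rewrite ME lin_B// lin_Z//; apply: le_trans (rnormD _ _) _.
  by rewrite rnormN rnormZ mulrDl lerD2l.
exists S; split.
- apply: (@bounded_A_bounded _ (complex.Re `|mu| - c)^-1) => // x.
  rewrite mulrC ler_pdivlMr ?subr_gt0//.
  have := congr1 B (S1 x); rewrite lin_B// sqrt_proj lin_Z// => e.
  have := rnormD (mu *: B (S x) - B (T (S x))) (B (T (S x))).
  rewrite subrK e rnormZ; have := hc (S x); lra.
- apply/funext => x /=.
  rewrite ME -[LHS](A_proj Apos HP) -[RHS](A_proj Apos HP).
  by rewrite -[in RHS](S1 x) !(lin_B _ _ lP) (proj_idem Apos HP).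
- apply/funext => x /=; rewrite ME -(A_proj Apos HP) PS.
  by rewrite (lin_B _ _ lP) -PTPE (lin_Z _ _ lP) S2 (A_proj Apos HP).
Qed.

End ASeminorm.

(** * Spectra in the corner algebra *)

Section CornerSpectra.
Context {R : realType} {H : hilbertType R} (M : set (H -> H)) (A P : H -> H).
Hypothesis HM : von_neumann_algebra M.
Hypothesis Apos : positive_operator A.
Hypothesis A0 : A <> 0.
Hypothesis HP : is_orthogonal_projection P (closure (range A)).

Lemma A_bounded_compress T : A_bounded M A T -> P \o T \o P = P \o T.
Proof.
move=> [MT Tfin]; have lT := (vna_bounded HM MT).1.
apply: (proj_compress Apos HP) => // k.
exact: (opseminorm_fin_ker Apos A0 lT Tfin).
Qed.

(** Composing with [P] on both sides sends a right [A]-inverse [S] of [lam - T]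
    to a right inverse [P S P] in the corner, since [P T P = P T] and
    [A u = A v] implies [P u = P v]. *)
Lemma right_spectrum_corner_sub T : A_bounded M A T ->
  right_spectrum (P \o T \o P) (corner M P) P `<=` right_A_spectrum M A T.
Proof.
move=> hT lam; apply: contra_not => -[_ [S [MS _] ATS]].
have lP := proj_linear Apos HP.
have PTP x : P (T (P x)) = P (T x) := congr1 (@^~ x) (A_bounded_compress hT).
exists (P \o S \o P); first by exists S.
apply/funext => x.
transitivity (P (lam *: S (P x) - T (S (P x)))).
  rewrite (lin_B _ _ lP) (lin_Z _ _ lP) -[in RHS]PTP.
  have PPE := proj_idem Apos HP (S (P x)).
  change (lam *: P (P (S (P x))) - P (T (P (P (S (P x))))) =
    lam *: P (S (P x)) - P (T (P (S (P x))))).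
  by rewrite PPE.
rewrite -[RHS](proj_idem Apos HP); apply: (proj_eq Apos HP).
exact: (congr1 (@^~ (P x)) ATS).
Qed.

(** On this side the identity that makes [P S P] an inverse is
    [P S P = P S], from the finite seminorm of the left [A]-inverse [S]. *)
Lemma left_spectrum_corner_sub T :
  left_spectrum (P \o T \o P) (corner M P) P `<=` left_A_spectrum M A T.
Proof.
move=> lam; apply: contra_not => -[_ [S hS AST]].
have lP := proj_linear Apos HP.
have PSP x : P (S (P x)) = P (S x) := congr1 (@^~ x) (A_bounded_compress hS).
exists (P \o S \o P); first by exists S => //; exact: hS.1.
apply/funext => x.
transitivity (P (S (P (lam *: P x - T (P x))))).
  rewrite /= PSP; congr (P (S _)); rewrite (lin_B _ _ lP) (lin_Z _ _ lP).
  by rewrite (proj_idem Apos HP).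
rewrite PSP -[RHS](proj_idem Apos HP); apply: (proj_eq Apos HP).
exact: (congr1 (@^~ (P x)) AST).
Qed.

End CornerSpectra.

(** * Operators with an adjoint for the square root *)

Section SqrtAdjoint.
Context {R : realType} {H : hilbertType R} (M : set (H -> H)) (A P B : H -> H).
Hypothesis HM : von_neumann_algebra M.
Hypothesis MA : M A.
Hypothesis Apos : positive_operator A.
Hypothesis A0 : A <> 0.
Hypothesis HP : is_orthogonal_projection P (closure (range A)).
Hypothesis HB : is_sqrt_operator A B.
Implicit Types (T L K Ts : H -> H).

(** Taking adjoints in [B T = L^* B] gives [B L = T^* B]: the roles of [T] and
    [L] can be exchanged. *)
Lemma sqrt_adjoint_norms T L K :
  M T -> M L -> is_adjoint L K -> B \o T = K \o B ->
  [/\ P \o T \o P = P \o T, P \o L \o P = P \o L,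
      opseminorm A T = opnorm (P \o L) & opseminorm A L = opnorm (P \o T)].
Proof.
move=> MT ML LK BT.
have [Ts MTs TTs] := vna_adjoint HM MT.
have [K' MK' LK'] := vna_adjoint HM ML.
have MK : M K by rewrite (adjoint_unique LK LK').
have BL := intertwine_adjoint HB LK TTs BT.
have lin X : M X -> linear X by move=> /(vna_bounded HM)[].
have K0 : K 0 = 0 by apply: lin_0; exact: lin.
have Ts0 : Ts 0 = 0 by apply: lin_0; exact: lin.
split.
- by apply: (proj_compress Apos HP); [exact: lin|exact: intertwine_ker BT].
- by apply: (proj_compress Apos HP); [exact: lin|exact: intertwine_ker BL].
- apply: (opseminorm_opnorm Apos HP HB A0 _ _ _ LK BT); [exact: lin| |].
    exact: lin.
  exact: vna_bounded MK.
- apply: (opseminorm_opnorm Apos HP HB A0 _ _ _ TTs BL); [exact: lin| |].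
    exact: lin.
  exact: vna_bounded MTs.
Qed.

(** The seminorm of [T] bounds the [A]-inverse, and that of [L], which is the
    norm of [P T], makes the Neumann series converge. *)
Lemma sqrt_adjoint_A_invertible T L K (mu : R[i]) :
  M T -> M L -> is_adjoint L K -> B \o T = K \o B ->
  (maxe (opseminorm A T) (opseminorm A L) < (complex.Re `|mu|)%:E)%E ->
  A_invertible M A (mu *: idfun + T) /\ A_invertible M A (mu *: idfun - T).
Proof.
move=> MT ML LK BT; have [PTP _ _ nL] := sqrt_adjoint_norms MT ML LK BT.
have lP := proj_linear Apos HP; have lB : linear B := HB.1.1.1.
have [K' MK' LK'] := vna_adjoint HM ML.
have K0 : K 0 = 0.
  by rewrite (adjoint_unique LK LK') lin_0//; exact: (vna_bounded HM MK').1.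
have lT := (vna_bounded HM MT).1.
have lPT : linear (P \o T) by move=> ? ? ? /=; rewrite lT lP.
have kT := intertwine_ker HB K0 BT.
have [x0 hx0] := seminorm_gt0 Apos A0.
have sup_ge0 X : (0 <= opseminorm A X)%E.
  apply: (@sup_unit_sphere_ge0 _ _ _ _ x0) => //.
    exact: seminorm_homogeneous.
  by move=> ?; exact: sqrtr_ge0.
have finE X m : (opseminorm A X < m%:E)%E -> exists c : R, [/\ 0 <= c, c < m
    & (opseminorm A X <= c%:E)%E].
  move=> Xm; have Xfin : opseminorm A X \is a fin_num.
    by rewrite ge0_fin_numE// (lt_trans Xm)// ltry.
  exists (fine (opseminorm A X)); rewrite fineK//.
  by split=> //; [exact: fine_ge0|rewrite -lte_fin fineK].
rewrite gt_max => /andP[/finE[c [_ cm /(opseminorm_leP HB _ lT kT) hc]]].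
move=> /finE[a [a0 am]]; rewrite nL => /(opnorm_leP _ lPT) ha.
have := A_invertible_scalar_sub Apos HP HB HM MA MT hc ha PTP a0 am cm.
have PTNP : P \o (- T) \o P = P \o (- T).
  apply/funext => x; rewrite /= !(lin_N _ lP); congr (- _).
  exact: (congr1 (@^~ x) PTP).
have := A_invertible_scalar_sub Apos HP HB HM MA
  (vna_opp HM MT) _ _ PTNP a0 am cm.
rewrite opprK => h; split=> //; apply: h => x.
  by rewrite (lin_N _ lB) rnormN.
by rewrite (lin_N _ lP) rnormN; exact: ha.
Qed.

End SqrtAdjoint.

Theorem theorem2p3 (R : realType) (H : hilbertType R) (M : set (H -> H))
    (A P : H -> H) (HM : von_neumann_algebra M) (MA : M A)
    (A_pos : positive_operator A) (A_neq0 : A <> 0)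
    (HP : is_orthogonal_projection P (closure (range A))) :
  [/\ (* (1) *)
      forall T : H -> H, A_bounded M A T ->
        right_spectrum (P \o T \o P) (corner M P) P `<=` right_A_spectrum M A T
        /\ left_spectrum (P \o T \o P) (corner M P) P `<=` left_A_spectrum M A T,
      (* (2) *)
      forall sqrtA T L Ladj : H -> H,
        is_sqrt_operator A sqrtA -> is_adjoint L Ladj ->
        A_adjointable M A T -> A_bounded M A L ->
        sqrtA \o T = Ladj \o sqrtA ->
        (opseminorm A T = opnorm (P \o L \o P) /\
         opnorm (P \o L \o P) = opnorm (P \o L)) /\
        (opseminorm A L = opnorm (P \o T \o P) /\
         opnorm (P \o T \o P) = opnorm (P \o T))
    & (* (3) *)
      forall (sqrtA T L Ladj : H -> H) (lam : R[i]),
        is_sqrt_operator A sqrtA -> is_adjoint L Ladj ->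
        A_adjointable M A T -> A_bounded M A L ->
        sqrtA \o T = Ladj \o sqrtA ->
        (maxe (opseminorm A T) (opseminorm A L) < (complex.Re `|lam|)%:E)%E ->
        [/\ A_invertible M A (lam *: idfun + T),
            A_invertible M A (lam *: idfun - T),
            A_invertible M A (lam^* *: idfun + T)
          & A_invertible M A (lam^* *: idfun - T)]].
Proof.
split.
- move=> T hT; split.
    exact: right_spectrum_corner_sub.
  exact: left_spectrum_corner_sub.
- move=> B T L K HB LK [MT _] [ML _] BT.
  by have [-> -> -> ->] := sqrt_adjoint_norms HM A_pos A_neq0 HP HB MT ML LK BT.
- move=> B T L K lam HB LK [MT _] [ML _] BT hlam.
  have inv := sqrt_adjoint_A_invertible HM MA A_pos A_neq0 HP HB MT ML LK BT.
  have [] := inv _ hlam; rewrite -norm_conjC in hlam.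
  by have [] := inv _ hlam.
Qed.
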